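(* The diagram formed by $\mathrm{flat}:\mathrm{Dend}(\{x,y\})^{\mathrm{conv}}\to\mathcal{W}^{\mathrm{conv}}_{\{x,y\}}$, $\zeta_{\mathrm{FI}}:\mathcal{W}^{\mathrm{conv}}_{\{x,y\}}\to\mathcal{A}_{\{x,y\}}$, $\zeta^{\mathrm{Dend}}:\mathrm{Dend}(\{x,y\})^{\mathrm{conv}}\to\mathcal{A}_{\{x,y\}}$, the evaluation map $\mathrm{ev}$ (defined on the convergent formal integrals of $\mathcal{A}_{\{x,y\}}$, with values in $\mathbb{R}$) and $\zeta_{\mathrm{int}}:\mathcal{W}^{\mathrm{conv}}_{\{x,y\}}\to\mathbb{R}$ commutes; that is, on $\mathrm{Dend}(\{x,y\})^{\mathrm{conv}}$ and $\mathcal{W}^{\mathrm{conv}}_{\{x,y\}}$ respectively, $$\zeta_{\mathrm{FI}}\circ\mathrm{flat}=\zeta^{\mathrm{Dend}}\qquad\text{and}\qquad \mathrm{ev}\circ\zeta_{\mathrm{FI}}=\zeta_{\mathrm{int}}.$$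
   Context: All vector spaces are over $\mathbb{R}$. **Dendriform algebras.** A dendriform algebra is a vector space $A$ with bilinear operations $\prec,\succ$ such that, with $x\star y:=x\prec y+x\succ y$, for all $x,y,z\in A$: $(x\prec y)\prec z=x\prec(y\star z)$; $(x\succ y)\prec z=x\succ(y\prec z)$; $(x\star y)\succ z=x\succ(y\succ z)$. ''Dendriform algebra'' always means the augmented one $\overline A=A\oplus\mathbb{R}1$ with $1\prec a=0=a\succ1$, $a\prec1=a=1\succ a$ for $a\in A$ (and $1\star1=1$). A morphism is a linear map sending $1$ to $1$, $A$ to $B$, and preserving $\prec,\succ$ on $A$. **Words.** $\mathcal{W}_{\{x,y\}}$ has basis the finite words on $\{x,y\}$, unit the empty word $\emptyset$; $\mathcal{W}^{\mathrm{conv}}_{\{x,y\}}$ is the span of $\emptyset$ and the words starting with $x$ and ending with $y$. The shuffle product $\star_s$ is defined by $u\star_s\emptyset=\emptyset\star_s u=u$ and, for nonempty $u=u_1\cdots u_n$, $v=v_1\cdots v_k$, $u\star_s v=u_1(u_2\cdots u_n\star_s v)+v_1(u\star_s v_2\cdots v_k)$. With $g_x(t)=1/t$, $g_y(t)=1/(1-t)$ on $(0,1)$, $\zeta_{\mathrm{int}}:\mathcal{W}^{\mathrm{conv}}_{\{x,y\}}\to\mathbb{R}$ is the linear map $\zeta_{\mathrm{int}}(\omega_1\cdots\omega_n)=\int_{0<u_n<\dots<u_1<1}\prod_{i=1}^n g_{\omega_i}(u_i)\,\mathrm{d}u_i$, $\zeta_{\mathrm{int}}(\emptyset)=1$. **Shuffles.**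 For $k,l\ge1$, $\mathrm{Sh}(k,l)$ is the set of $\sigma\in S_{k+l}$ with $\sigma(1)<\dots<\sigma(k)$ and $\sigma(k+1)<\dots<\sigma(k+l)$. **Formal integrals.** For $n\in\mathbb{N}$, let $\mathrm{B}_{\mathrm{int}}(\mathbb{R}^n)$ be the set of Borel subsets of $\mathbb{R}^n$ modulo Lebesgue-negligible ones, and $\mathfrak{B}(\mathbb{R}^n)$ the quotient of the algebra $(\mathbb{R}\mathrm{B}_{\mathrm{int}}(\mathbb{R}^n),+,\cup)$ by the ideal generated by the $A\cup B-A-B+A\cap B$. Let $G(x)=g_x$, $G(y)=g_y$. A formal integral $B\otimes w\times G$, also written $\int_B(\prod_i g_{w_i})\mathrm{d}t_1\cdots\mathrm{d}t_k$, is a pair consisting of an element of $\langle\mathfrak{B}(\mathbb{R}^{\ell(w)})\otimes w\mid w\text{ a word on }\{x,y\}\rangle$ ($\ell$ = length) and of $G$; it is purely formal and vector space operations are those of the first component. $\mathcal{A}_{\{x,y\}}$ is the span of all $\int_{0<t_r<\dots<t_1<1}\prod_{i=1}^r g_{\omega_i}\mathrm{d}t_i$, $r\ge0$ (for $r=0$: $\emptyset\otimes\emptyset\times G$, the unit). For $\alpha=\int_{0<t_k<\dots<t_1<1}\prod_{i=1}^k g_{\omega_i}\mathrm{d}t_i$, $\beta=\int_{0<t_{k+l}<\dots<t_{k+1}<1}\prod_{i=k+1}^{k+l}g_{\omega_i}\mathrm{d}t_i$ ($k,l\ge1$), $\alpha\prec\beta$ (resp. $\alpha\succ\beta$) is $\sum_\sigma\int_{0<t_{k+l}<\dots<t_1<1}\prod_{i=1}^{k+l}g_{\omega_{\sigma^{-1}(i)}}\mathrm{d}t_i$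 over $\sigma\in\mathrm{Sh}(k,l)$ with $\sigma^{-1}(1)=1$ (resp. $=k+1$). It is a dendriform algebra. $\zeta_{\mathrm{FI}}$ is the linear map $\omega_1\cdots\omega_k\mapsto\int_{0<t_k<\dots<t_1<1}\prod_{i=1}^k g_{\omega_i}\mathrm{d}t_i$, $\emptyset\mapsto\emptyset\otimes\emptyset\times G$. A spanning element $\int_A\prod_i g_{\omega_i}\mathrm{d}t_i$ of $\mathcal{A}_{\{x,y\}}$ is convergent if the word $\omega_1\cdots\omega_k$ is empty or starts with $x$ and ends with $y$; $\mathrm{ev}$ is the linear map on the span of these sending $\int_A\prod_{i=1}^k g_{\omega_i}\mathrm{d}t_i$ to the real number $\int_A\prod_{i=1}^k g_{\omega_i}(t_i)\,\mathrm{d}t_i$ and the unit to $1$. **Binary trees.** $\mathrm{Dend}(\{x,y\})$ is the vector space with basis the planar binary rooted trees (each internal vertex has exactly two children) with internal vertices decorated by $x$ or $y$, including the tree $|$ with no internal vertex. $Y_z$ is the tree with a single internal vertex, decorated by $z$. For trees $t,s\ne|$, let $v_1$ (the root), $\dots,v_k$ be the internal vertices on the rightmost branch of $t$, with decorations $w_1,\dots,w_k$ and left subtrees $F_1,\dots,F_k$; let $v_{k+1}$ (the root), $\dots,v_{k+l}$ be the internal vertices on the leftmost branch of $s$, with decorations $w_{k+1},\dots,w_{k+l}$ and right subtrees $F_{k+1},\dots,F_{k+l}$. For $\sigma\in\mathrm{Sh}(k,l)$, $\sigma(t,s)$ is obtained from the ladder with nodes $1$ (root), $\dots,k+l$, ended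 above by a leaf, by grafting $F_i$ at node $\sigma(i)$, to the left of the ladder if $i\le k$ and to the right if $i>k$, node $\sigma(i)$ being decorated by $w_i$. Then $t\prec s$ (resp. $t\succ s$) is $\sum\sigma(t,s)$ over $\sigma\in\mathrm{Sh}(k,l)$ with $\sigma^{-1}(1)=1$ (resp. $=k+1$); $|$ is the unit. It is known that $\mathrm{Dend}(\{x,y\})$ is the free dendriform algebra on $\{x,y\}$ via $z\mapsto Y_z$. $\mathrm{Dend}(\{x,y\})^{\mathrm{conv}}$ is the span of $|$ and the trees whose root is decorated by $x$ and whose maximal internal vertices (those with no internal vertex above them) are decorated by $y$. **Maps.** $\zeta^{\mathrm{Dend}}:\mathrm{Dend}(\{x,y\})\to\mathcal{A}_{\{x,y\}}$ is the unique dendriform morphism with $\zeta^{\mathrm{Dend}}(Y_z)=\int_{0<t<1}g_z\mathrm{d}t$ (formal integral). $\mathrm{flat}$ is the linear map with $\mathrm{flat}(|)=\emptyset$ and, for $t$ with root decorated by $z$ and subtrees $t_1,t_2$ at the children of the root, $\mathrm{flat}(t)=z(\mathrm{flat}(t_1)\star_s\mathrm{flat}(t_2))$. *)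

(* Defs.v *)
From HB Require Import structures.
From mathcomp Require Import all_boot all_order all_algebra all_fingroup.
From mathcomp Require Import generic_quotient ring_quotient finmap.
From mathcomp Require Import monalg.
From mathcomp Require Import all_classical all_reals all_analysis.

Set Implicit Arguments.
Unset Strict Implicit.
Unset Printing Implicit Defensive.

Import Order.TTheory GRing.Theory Num.Theory.
Local Open Scope classical_set_scope.
Local Open Scope ring_scope.

Section linear_extension.
Context {R : comNzRingType} {K L : choiceType} {V : lmodType R}.

Definition linext (f : K -> V) (p : {malg R[K]}) : V :=
  \sum_(k <- msupp p) p@_k *: f k.

Definition bilinext (f : K -> L -> V) (p : {malg R[K]}) (q : {malg R[L]}) : V :=
  \sum_(k <- msupp p) \sum_(l <- msupp q) (p@_k * q@_l) *: f k l.

Lemma linextEw (f : K -> V) (p : {malg R[K]}) (d : {fset K}) :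
  (msupp p `<=` d)%fset -> linext f p = \sum_(k <- d) p@_k *: f k.
Proof.
move=> pd; rewrite /linext (big_fset_incl _ pd)//= => k _ kp.
by rewrite mcoeff_outdom// scale0r.
Qed.

Lemma linext_is_linear (f : K -> V) : linear (linext f).
Proof.
move=> c p q; set d := (msupp p `|` msupp q `|` msupp (c *: p + q))%fset.
rewrite !(@linextEw _ _ d).
- rewrite scaler_sumr -big_split/=; apply: eq_bigr => k _.
  by rewrite mcoeffD mcoeffZ scalerDl scalerA.
- by apply/fsubsetP => k kq; rewrite !in_fsetU kq orbT.
- by apply/fsubsetP => k kp; rewrite !in_fsetU kp.
- exact: fsubsetUr.
Qed.

HB.instance Definition _ (f : K -> V) :=
  GRing.isLinear.Build R {malg R[K]} V _ (linext f) (linext_is_linear f).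

Lemma linextU (f : K -> V) (k : K) : linext f << k >> = f k.
Proof.
by rewrite (@linextEw _ _ [fset k]%fset) ?msuppU_le// big_seq_fset1 mcoeffUU scale1r.
Qed.

Lemma bilinextUU (f : K -> L -> V) (k : K) (l : L) :
  bilinext f << k >> << l >> = f k l.
Proof.
rewrite /bilinext !msuppU oner_eq0 !big_seq_fset1.
by rewrite !mcoeffUU mulr1 scale1r.
Qed.

End linear_extension.

Section span.
Context {R : comNzRingType} {V : lmodType R}.

Definition subspace (W : set V) : Prop :=
  W 0 /\ forall (a : R) u v, W u -> W v -> W (a *: u + v).

Definition lspan (S : set V) : set V := smallest subspace S.

Lemma lspan_subspace (S : set V) : subspace (lspan S).
Proof.
split=> [W [[]]//|a u v Su Sv W WS].
by have [[_ h] _] := WS; apply: h; [exact: Su|exact: Sv].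
Qed.

End span.

Section direct_sum.
Context {R : comNzRingType} {I : choiceType} (V : I -> lmodType R).

Record dsum := DSum {
  dsum_fun :> forall i, V i ;
  dsum_finite : exists s : seq I, forall i, i \notin s -> dsum_fun i = 0 }.

HB.instance Definition _ := gen_eqMixin dsum.
HB.instance Definition _ := gen_choiceMixin dsum.

Lemma dsumP (f g : dsum) : (forall i, f i = g i) -> f = g.
Proof.
case: f g => [f hf] [g hg] /= fg.
have {}fg : f = g by apply: functional_extensionality_dep.
by subst g; congr DSum; exact: Prop_irrelevance.
Qed.

Fact dsum0_finite : exists s : seq I, forall i, i \notin s -> 0 = 0 :> V i.
Proof. by exists [::]. Qed.
Definition dsum0 := @DSum (fun=> 0) dsum0_finite.

Fact dsumN_finite (f : dsum) :
  exists s : seq I, forall i, i \notin s -> - f i = 0.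
Proof. by case: f => f [s hs] /=; exists s => i /hs ->; rewrite oppr0. Qed.
Definition dsumN f := DSum (dsumN_finite f).

Fact dsumD_finite (f g : dsum) :
  exists s : seq I, forall i, i \notin s -> f i + g i = 0.
Proof.
case: f g => f [s hs] [g [t ht]] /=; exists (s ++ t) => i.
by rewrite mem_cat negb_or => /andP[/hs -> /ht ->]; rewrite addr0.
Qed.
Definition dsumD f g := DSum (dsumD_finite f g).

Fact dsumZ_finite (a : R) (f : dsum) :
  exists s : seq I, forall i, i \notin s -> a *: f i = 0.
Proof. by case: f => f [s hs] /=; exists s => i /hs ->; rewrite scaler0. Qed.
Definition dsumZ a f := DSum (dsumZ_finite a f).

Fact dsumDA : associative dsumD.
Proof. by move=> f g h; apply: dsumP => i /=; rewrite addrA. Qed.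
Fact dsumDC : commutative dsumD.
Proof. by move=> f g; apply: dsumP => i /=; rewrite addrC. Qed.
Fact dsum0D : left_id dsum0 dsumD.
Proof. by move=> f; apply: dsumP => i /=; rewrite add0r. Qed.
Fact dsumND : left_inverse dsum0 dsumN dsumD.
Proof. by move=> f; apply: dsumP => i /=; rewrite addNr. Qed.
HB.instance Definition _ := GRing.isZmodule.Build dsum dsumDA dsumDC dsum0D dsumND.

Fact dsumZA a b (f : dsum) : dsumZ a (dsumZ b f) = dsumZ (a * b) f.
Proof. by apply: dsumP => i /=; rewrite scalerA. Qed.
Fact dsum1Z : left_id 1 dsumZ.
Proof. by move=> f; apply: dsumP => i /=; rewrite scale1r. Qed.
Fact dsumZDr : right_distributive dsumZ +%R.
Proof. by move=> a f g; apply: dsumP => i /=; rewrite scalerDr. Qed.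
Fact dsumZDl (f : dsum) : {morph dsumZ^~ f : a b / a + b}.
Proof. by move=> a b; apply: dsumP => i /=; rewrite scalerDl. Qed.
HB.instance Definition _ :=
  GRing.Zmodule_isLmodule.Build R dsum dsumZA dsum1Z dsumZDr dsumZDl.

Definition dsum_at (i : I) (x : V i) (j : I) : V j :=
  if i =P j is ReflectT e then ecast k (V k) e x else 0.

Fact dsum_at_finite (i : I) (x : V i) :
  exists s : seq I, forall j, j \notin s -> dsum_at x j = 0.
Proof.
exists [:: i] => j; rewrite inE eq_sym /dsum_at => /negP ij.
by case: eqP => // e; case: ij; apply/eqP.
Qed.
Definition dsum_in (i : I) (x : V i) := DSum (dsum_at_finite x).

Lemma dsum_in_same (i : I) (x : V i) : dsum_in x i = x.
Proof.
rewrite /= /dsum_at; case: eqP => // e.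
by rewrite (Prop_irrelevance e erefl).
Qed.

Lemma dsum_in_neq (i j : I) (x : V i) : i != j -> dsum_in x j = 0.
Proof. by rewrite /= /dsum_at => /negP ij; case: eqP => // e; case: ij; apply/eqP. Qed.

End direct_sum.

Section lebesgue_Rn.
Context {R : realType}.

Definition cons_tup (n : nat) (p : n.-tuple R * R) : n.+1.-tuple R :=
  [tuple of p.2 :: p.1].

Lemma measurable_cons_tup (n : nat) : measurable_fun setT (@cons_tup n).
Proof.
exact: (measurable_cons (f := snd) (g := fst) measurable_snd measurable_fst).
Qed.

(* In successor dimension: the image under [cons_tup] of the product measure
   [lebn n' \x lebesgue_measure]. *)
Fixpoint lebn (n : nat) : {measure set (n.-tuple R) -> \bar R} :=
  match n return {measure set (n.-tuple R) -> \bar R} with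
  | 0 => \d_ [tuple]
  | n'.+1 =>
      measure_function_pushforward__canonical__measure_function_Measure
        (product_measure1 (lebn n') lebesgue_measure) (@measurable_cons_tup n')
  end.

Definition simplex (n : nat) : set (n.-tuple R) :=
  [set t | (forall i, 0 < tnth t i < 1) /\
           (forall i j : 'I_n, (i < j)%N -> tnth t j < tnth t i)].

Lemma measurable_simplex (n : nat) : measurable (@simplex n).
Proof.
have -> : @simplex n =
    (\bigcap_(i in [set: 'I_n]) [set t | 0 < tnth t i < 1]) `&`
    (\bigcap_(p in [set p : 'I_n * 'I_n | (p.1 < p.2)%N])
       [set t | tnth t p.2 < tnth t p.1]).
  apply/seteqP; split => t [h1 h2]; split.
  - by move=> i _; exact: h1.
  - by move=> [i j] ij; exact: h2.
  - by move=> i; exact: h1.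
  - by move=> i j ij; exact: (h2 (i, j)).
have mlt (f g : n.-tuple R -> R) : measurable_fun setT f ->
    measurable_fun setT g -> measurable [set t | f t < g t].
  move=> mf mg; rewrite -[X in measurable X]setTI.
  exact: (measurable_realfun.measurable_fun_ltr mf mg measurableT (Y := [set true])).
apply: measurableI; apply: fin_bigcap_measurable => //.
- move=> i _; have -> : [set t : n.-tuple R | 0 < tnth t i < 1] =
      [set t | 0 < tnth t i] `&` [set t | tnth t i < 1].
    by apply/seteqP; split => t /= => [/andP[]//|[-> ->]].
  by apply: measurableI; apply: mlt => //; exact: measurable_tnth.
- by move=> p _; apply: mlt; exact: measurable_tnth.
Qed.

Lemma measurable_setY (n : nat) (A B : set (n.-tuple R)) :
  measurable A -> measurable B -> measurable (A `+` B).
Proof.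
by move=> mA mB; apply: measurableU; exact: measurableD.
Qed.

End lebesgue_Rn.
Arguments simplex {R} n.

Section borel_mod_negligible.
Context (R : realType) (n : nat).

Definition borel : Type := {A : set (n.-tuple R) | A \in measurable}.
HB.instance Definition _ := Choice.on borel.
Implicit Types A B C : borel.

Definition mkborel (A : set (n.-tuple R)) (mA : measurable A) : borel :=
  exist _ A (mem_set mA).

Lemma borelP A : measurable (val A).
Proof. exact/set_mem/(valP A). Qed.

Definition borelU A B : borel := mkborel (measurableU _ _ (borelP A) (borelP B)).
Definition borelI A B : borel := mkborel (measurableI _ _ (borelP A) (borelP B)).
Definition borel0 : borel := mkborel measurable0.

Definition borel_eq A B : bool :=
  `[< (lebn n).-negligible (val A `+` val B) >].

Lemma borel_eqW A B C D :
  (val A `+` val B) `<=` (val C `+` val D) -> borel_eq C D -> borel_eq A B.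
Proof. by move=> h /asboolP CD; apply/asboolP; exact: negligibleS CD. Qed.

Lemma borel_eqWU A B C D E F :
  (val A `+` val B) `<=` (val C `+` val D) `|` (val E `+` val F) ->
  borel_eq C D -> borel_eq E F -> borel_eq A B.
Proof.
move=> h /asboolP CD /asboolP EF; apply/asboolP; apply: negligibleS h _.
exact: negligibleU.
Qed.

Lemma borel_eq_equiv : equiv_class_of borel_eq.
Proof.
split=> [A|A B|B A C].
- by apply/asboolP; rewrite setYK; exact: negligible_set0.
- by rewrite /borel_eq setYC.
- apply: borel_eqWU => t [] [] /= h1 h2.
  + by case: (pselect (val B t)) => h; [right; left|left; left].
  + by case: (pselect (val B t)) => h; [left; right|right; right].
Qed.

Canonical borel_eq_rel := EquivRelPack borel_eq_equiv.

Definition Bint : Type := {eq_quot borel_eq}%qT.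
HB.instance Definition _ := Choice.on Bint.
HB.instance Definition _ : EqQuotient borel borel_eq Bint := EqQuotient.on Bint.

Definition Bcls (A : borel) : Bint := (\pi_Bint A)%qT.

Lemma BclsP A B : Bcls A = Bcls B <-> borel_eq A B.
Proof. by split=> [/eqP|] h; [move: h; rewrite piE|apply/eqP; rewrite piE]. Qed.

Definition BintU (a b : Bint) : Bint := Bcls (borelU (repr a) (repr b)).
Definition BintI (a b : Bint) : Bint := Bcls (borelI (repr a) (repr b)).
Definition Bint0 : Bint := Bcls borel0.

Lemma repr_Bcls A : borel_eq (repr (Bcls A)) A.
Proof. by apply/BclsP; rewrite /Bcls reprK. Qed.

Lemma Bcls_repr (a : Bint) : Bcls (repr a) = a.
Proof. exact: reprK. Qed.

Lemma BintUE A B : BintU (Bcls A) (Bcls B) = Bcls (borelU A B).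
Proof.
apply/BclsP; apply: borel_eqWU (repr_Bcls A) (repr_Bcls B) => t /=.
rewrite /setY /setU /setD /=; tauto.
Qed.

Lemma BintIE A B : BintI (Bcls A) (Bcls B) = Bcls (borelI A B).
Proof.
apply/BclsP; apply: borel_eqWU (repr_Bcls A) (repr_Bcls B) => t /=.
case: (pselect (val A t)) => hA; case: (pselect (val B t)) => hB;
case: (pselect (val (repr (Bcls A)) t)) => hA';
case: (pselect (val (repr (Bcls B)) t)) => hB';
rewrite /setY /setU /setD /setI /=; tauto.
Qed.

Lemma eq_borel A B : val A = val B -> A = B.
Proof. exact: val_inj. Qed.

Fact BintUA : associative BintU.
Proof.
move=> a b c; rewrite -(Bcls_repr a) -(Bcls_repr b) -(Bcls_repr c) !BintUE.
by congr Bcls; apply: eq_borel; rewrite /= setUA.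
Qed.

Fact BintUC : commutative BintU.
Proof.
move=> a b; rewrite -(Bcls_repr a) -(Bcls_repr b) !BintUE.
by congr Bcls; apply: eq_borel; rewrite /= setUC.
Qed.

Fact Bint0U : left_id Bint0 BintU.
Proof.
move=> a; rewrite -(Bcls_repr a) BintUE.
by congr Bcls; apply: eq_borel; rewrite /= set0U.
Qed.

Fact BintU0 : right_id Bint0 BintU.
Proof. by move=> a; rewrite BintUC Bint0U. Qed.

Fact BintU_eq0 a b : BintU a b = Bint0 -> a = Bint0 /\ b = Bint0.
Proof.
rewrite -(Bcls_repr a) -(Bcls_repr b) BintUE => /BclsP h.
by split; apply/BclsP; apply: borel_eqW h => t /=;
  rewrite /setY /setU /setD /=; tauto.
Qed.

(* [{malg R[Bint]}] is then the algebra [(R Bint, +, union)]. *)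
HB.instance Definition _ :=
  Choice_isMonomialDef.Build Bint BintUA Bint0U BintU0 BintU_eq0.
HB.instance Definition _ := MonomialDef_isConomialDef.Build Bint BintUC.

Definition generated_ideal (S : comNzRingType) (X : set S) : set S :=
  smallest (fun I : set S => I 0 /\ forall a u v, I u -> I v -> I (a * u + v)) X.

Definition incl_excl : set {malg R[Bint]} :=
  [set << BintU a b >> - << a >> - << b >> + << BintI a b >> |
     a in setT & b in setT].

Definition incl_excl_ideal : {pred {malg R[Bint]}} :=
  fun p => `[< generated_ideal incl_excl p >].

Lemma incl_excl_idealD (a u v : {malg R[Bint]}) :
  u \in incl_excl_ideal -> v \in incl_excl_ideal ->
  a * u + v \in incl_excl_ideal.
Proof.
move=> /asboolP hu /asboolP hv; apply/asboolP => I hI.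
by have [[_ h] _] := hI; apply: h; [exact: hu|exact: hv].
Qed.

Fact incl_excl_ideal_closed : zmod_closed incl_excl_ideal.
Proof.
have h0 : 0 \in incl_excl_ideal by apply/asboolP => I [[]].
split=> // u v hu hv; rewrite addrC -mulN1r.
exact: incl_excl_idealD.
Qed.
HB.instance Definition _ :=
  GRing.isZmodClosed.Build {malg R[Bint]} incl_excl_ideal incl_excl_ideal_closed.

Lemma incl_excl_idealZ (c : R) (u : {malg R[Bint]}) :
  u \in incl_excl_ideal -> c *: u \in incl_excl_ideal.
Proof.
move=> hu; rewrite -mul_malgC -[_ * _]addr0.
by apply: incl_excl_idealD => //; exact: rpred0.
Qed.

Definition frakB : Type := Quotient.quot incl_excl_ideal.
HB.instance Definition _ := GRing.Zmodule.on frakB.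

Definition frakB_pi (p : {malg R[Bint]}) : frakB := (\pi_frakB p)%qT.

Lemma frakB_piP p q : frakB_pi p = frakB_pi q <-> p - q \in incl_excl_ideal.
Proof.
by rewrite Quotient.idealrBE; split => [e|/eqP//]; apply/eqP.
Qed.

Lemma frakB_piK (x : frakB) : frakB_pi (repr x) = x.
Proof. exact: reprK. Qed.

Lemma frakB_piD p q : frakB_pi (p + q) = frakB_pi p + frakB_pi q.
Proof. exact: raddfD. Qed.

Definition frakBZ (c : R) (x : frakB) : frakB := frakB_pi (c *: repr x).

Lemma frakB_piZ c p : frakB_pi (c *: p) = frakBZ c (frakB_pi p).
Proof.
apply/frakB_piP; rewrite -scalerBr; apply: incl_excl_idealZ.
by apply/frakB_piP; rewrite frakB_piK.
Qed.

Fact frakBZA c d x : frakBZ c (frakBZ d x) = frakBZ (c * d) x.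
Proof. by rewrite -(frakB_piK x) -!frakB_piZ scalerA. Qed.
Fact frakB1Z : left_id 1 frakBZ.
Proof. by move=> x; rewrite -(frakB_piK x) -!frakB_piZ scale1r. Qed.
Fact frakBZDr : right_distributive frakBZ +%R.
Proof.
move=> c x y; rewrite -(frakB_piK x) -(frakB_piK y).
by rewrite -frakB_piD -!frakB_piZ -frakB_piD scalerDr.
Qed.
Fact frakBZDl x : {morph frakBZ^~ x : c d / c + d}.
Proof.
by move=> c d; rewrite -(frakB_piK x) -!frakB_piZ scalerDl frakB_piD.
Qed.
HB.instance Definition _ :=
  GRing.Zmodule_isLmodule.Build R frakB frakBZA frakB1Z frakBZDr frakBZDl.

Definition Bclass (A : set (n.-tuple R)) (mA : measurable A) : frakB :=
  frakB_pi << Bcls (mkborel mA) >>.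

(* The constant function 1 on Borel sets is a valuation, hence it factors
   through [frakB]; in particular the class of a Borel set is never 0. *)
Definition mass (p : {malg R[Bint]}) : R := linext (fun=> 1 : R^o) p.

Lemma massZD c p q : mass (c *: p + q) = c * mass p + mass q.
Proof. exact: linearP. Qed.

Lemma massD p q : mass (p + q) = mass p + mass q.
Proof. exact: raddfD. Qed.

Lemma massB p q : mass (p - q) = mass p - mass q.
Proof. exact: raddfB. Qed.

Lemma massU a : mass << a >> = 1.
Proof. exact: linextU. Qed.

Lemma massM p q : mass (p * q) = mass p * mass q.
Proof.
rewrite malgME /mass !raddf_sum mulr_suml; apply: eq_bigr => a _.
rewrite raddf_sum mulr_sumr; apply: eq_bigr => b _ /=.
rewrite (@linextEw _ _ _ _ _ [fset (mmul a b)]%fset) ?msuppU_le//.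
by rewrite big_seq_fset1 mcoeffUU /GRing.scale/= !mulr1.
Qed.

Lemma mass_ideal p : p \in incl_excl_ideal -> mass p = 0.
Proof.
move=> /asboolP h; apply: (h [set p | mass p = 0]); split; first split.
- exact: (raddf0 (linext (fun=> 1 : R^o))).
- by move=> a u v /= hu hv; rewrite massD massM hu hv mulr0 addr0.
- by move=> _ [a _ [b _ <-]] /=; rewrite massD !massB !massU subrr sub0r addNr.
Qed.

Definition frakB_mass (x : frakB) : R := mass (repr x).

Lemma frakB_massE p : frakB_mass (frakB_pi p) = mass p.
Proof.
apply/eqP; rewrite -subr_eq0; apply/eqP.
rewrite /frakB_mass -massB.
by apply: mass_ideal; apply/frakB_piP; rewrite frakB_piK.
Qed.

Lemma frakB_mass_Bclass (A : set (n.-tuple R)) (mA : measurable A) : frakB_mass (Bclass mA) = 1.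
Proof. by rewrite frakB_massE massU. Qed.

Lemma frakB_massZD c x y :
  frakB_mass (c *: x + y) = c * frakB_mass x + frakB_mass y.
Proof.
rewrite -(frakB_piK x) -(frakB_piK y).
have -> : c *: frakB_pi (repr x) = frakB_pi (c *: repr x) by rewrite frakB_piZ.
by rewrite -frakB_piD !frakB_massE massZD.
Qed.

End borel_mod_negligible.

Variant letter := Lx | Ly.

Definition letter_bool (z : letter) : bool := if z is Lx then true else false.
Definition bool_letter (b : bool) : letter := if b then Lx else Ly.
Fact letter_boolK : cancel letter_bool bool_letter. Proof. by case. Qed.
HB.instance Definition _ := Countable.copy letter (can_type letter_boolK).

Notation word := (seq letter).

Definition Words (R : realType) : lmodType R := {malg R[word]}.

Definition conv_word (w : word) : bool :=
  if w is a :: w' then (a == Lx) && (last a w' == Ly) else true.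

Section words.
Context (R : realType).

Definition Wconv : set (Words R) :=
  lspan [set << w >> | w in [set w | conv_word w]].

Definition wcons (a : letter) : Words R -> Words R :=
  linext (fun w => << a :: w >>).

Fixpoint shuffle_word (u : word) : word -> Words R :=
  if u is a :: u' then
    fix shuffle_u (v : word) : Words R :=
      if v is b :: v' then
        wcons a (shuffle_word u' v) + wcons b (shuffle_u v')
      else << u >>
  else fun v => << v >>.

Definition shuffle (p q : Words R) : Words R := bilinext shuffle_word p q.

End words.

Definition Sh (k l : nat) : {set 'S_(k + l)} :=
  [set s : 'S_(k + l) |
    [forall i : 'I_(k + l), forall j : 'I_(k + l),
      (i < j)%N && ((j < k)%N || (k <= i)%N) ==> (s i < s j)%N]].

(* [s^-1 0 = m]; indices are 0-based, and ['I_n] may have no element 0. *)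
Definition inv0 (n : nat) (s : 'S_n) (m : nat) : bool :=
  [forall i : 'I_n, (i == 0 :> nat) ==> ((s^-1)%g i == m :> nat)].

(* The sequence whose i-th item is the (s^-1 i)-th item of [u ++ v]. *)
Definition merge_by (T : Type) (u v : seq T) (s : 'S_(size u + size v)) : seq T :=
  [seq tnth (cat_tuple (in_tuple u) (in_tuple v)) ((s^-1)%g i)
    | i <- enum 'I_(size u + size v)].

(* The data of an augmented dendriform algebra [A + R 1], with [aug_ideal] the
   subspace [A]; the dendriform identities play no role in the notion of
   morphism. The products of 1 with itself are irrelevant (the two instances
   below set them to 0). *)
Record aug_dend_data (R : realType) := AugDend {
  dend_car :> lmodType R ;
  dend_one : dend_car ;
  aug_ideal : set dend_car ;
  dend_prec : dend_car -> dend_car -> dend_car ;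
  dend_succ : dend_car -> dend_car -> dend_car }.

Record dend_morphism (R : realType) (A B : aug_dend_data R) (f : A -> B) : Prop := {
  dend_morph_linear : linear f ;
  dend_morph1 : f (dend_one A) = dend_one B ;
  dend_morph_aug : forall a, aug_ideal a -> aug_ideal (f a) ;
  dend_morph_prec : forall a b, aug_ideal a -> aug_ideal b ->
    f (dend_prec a b) = dend_prec (f a) (f b) ;
  dend_morph_succ : forall a b, aug_ideal a -> aug_ideal b ->
    f (dend_succ a b) = dend_succ (f a) (f b) }.

Section formal_integrals.
Context (R : realType).

(* The pair (element of the direct sum, G) is encoded by indexing the type
   by [G]: vector space operations only combine integrals with the same [G]. *)
Definition formal_integral (G : letter -> R -> R) : lmodType R :=
  dsum (fun w : word => frakB R (size w) : lmodType R).

Definition formal_int (G : letter -> R -> R) (w : word)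
    (B : set ((size w).-tuple R)) (mB : measurable B) : formal_integral G :=
  dsum_in (V := fun w : word => frakB R (size w) : lmodType R) (i := w)
    (Bclass mB).

Definition g (z : letter) (t : R) : R :=
  match z with Lx => t^-1 | Ly => (1 - t)^-1 end.

(* By convention the formal integral over no variable is the class of the empty
   set tensored with the empty word. *)
Definition domain (n : nat) : set (n.-tuple R) :=
  if n == 0%N then set0 else simplex n.

Fact measurable_domain (n : nat) : measurable (@domain n).
Proof. by rewrite /domain; case: eqP => // _; exact: measurable_simplex. Qed.

Definition simplex_int (w : word) : formal_integral g :=
  formal_int g (@measurable_domain (size w)).

Definition calA_pred : {pred formal_integral g} :=
  fun v => `[< lspan (range simplex_int) v >].

Fact calA_submod_closed : submod_closed calA_pred.
Proof.
have [h0 hD] := lspan_subspace (range simplex_int).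
split; first exact/asboolP.
by move=> c u v /asboolP hu /asboolP hv; apply/asboolP; exact: hD.
Qed.
HB.instance Definition _ :=
  GRing.isSubmodClosed.Build R (formal_integral g) calA_pred calA_submod_closed.

Record calA := CalA { calA_val :> formal_integral g ; _ : calA_val \in calA_pred }.
HB.instance Definition _ := [isSub for calA_val].
HB.instance Definition _ := [Choice of calA by <:].
HB.instance Definition _ := [SubChoice_isSubLmodule of calA by <:].

Fact simplex_int_calA (w : word) : simplex_int w \in calA_pred.
Proof. by apply/asboolP => W [_]; apply; exists w. Qed.
Definition fint (w : word) : calA := CalA (simplex_int_calA w).

Definition zeta_FI : Words R -> calA := linext fint.

(* The [fint w] form a basis of [calA] (see [zeta_FIK] and [coordsK]), and
   [coords] gives the coordinates in it; linear maps out of [calA] are defined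
   by their values on this basis. *)
Definition coords (a : calA) : Words R := xget 0 [set p | zeta_FI p = a].

Lemma zeta_FI_surj (a : calA) : exists p, zeta_FI p = a.
Proof.
case: a => v hv; have /asboolP h := hv.
suff [p hp] : [set v | exists p, calA_val (zeta_FI p) = v] v.
  by exists p; exact: val_inj.
apply: h; split; first split.
- by exists 0; rewrite /zeta_FI linear0.
- move=> c _ _ [p <-] [q <-]; exists (c *: p + q).
  by rewrite /zeta_FI linearP.
- by move=> _ [w _ <-]; exists << w >>; rewrite /zeta_FI linextU.
Qed.

Lemma mass_zeta_FI (p : Words R) (w : word) :
  frakB_mass (dsum_fun (calA_val (zeta_FI p)) w) = p@_w.
Proof.
have mass0 : frakB_mass (0 : frakB R (size w)) = 0.
  have := frakB_massZD (-1) (0 : frakB R (size w)) 0.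
  by rewrite scaler0 addr0 mulN1r addNr.
have -> : p@_w = \sum_(k <- msupp p) p@_k * (k == w)%:R.
  rewrite {1}[p]monalgE raddf_sum/=; apply: eq_bigr => k _.
  by rewrite mcoeffU mulr_natr.
rewrite /zeta_FI /linext; elim: (enum_fset (msupp p)) => [|k s IH].
  by rewrite !big_nil.
rewrite !big_cons -{}IH [LHS]frakB_massZD; congr (_ * _ + _).
have [->|kw] := eqVneq k w; first by rewrite dsum_in_same frakB_mass_Bclass.
by rewrite dsum_in_neq.
Qed.

Lemma zeta_FI_inj : injective zeta_FI.
Proof.
by move=> p q pq; apply/malgP => w; rewrite -!mass_zeta_FI pq.
Qed.

Lemma zeta_FIK : cancel zeta_FI coords.
Proof.
move=> p; apply: zeta_FI_inj.
exact: (xgetI 0 (P := [set q | zeta_FI q = zeta_FI p]) (x := p) erefl).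
Qed.

Lemma coordsK : cancel coords zeta_FI.
Proof.
by move=> a; have [p <-] := zeta_FI_surj a; rewrite zeta_FIK.
Qed.

Lemma coords_fint (w : word) : coords (fint w) = << w >>.
Proof. by rewrite -[RHS]zeta_FIK /zeta_FI linextU. Qed.

Lemma coords_is_linear : linear coords.
Proof.
move=> c a b; apply: zeta_FI_inj.
by rewrite /zeta_FI linearP/= -!/(zeta_FI _) !coordsK.
Qed.

Definition fint_prec (u v : word) : calA :=
  if nilp u then 0 else if nilp v then fint u else
  \sum_(s in Sh (size u) (size v) | inv0 s 0) fint (merge_by s).

Definition fint_succ (u v : word) : calA :=
  if nilp v then 0 else if nilp u then fint v else
  \sum_(s in Sh (size u) (size v) | inv0 s (size u)) fint (merge_by s).

Definition calA_prec (a b : calA) : calA :=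
  bilinext fint_prec (coords a) (coords b).
Definition calA_succ (a b : calA) : calA :=
  bilinext fint_succ (coords a) (coords b).

Lemma calA_prec_fint (u v : word) : calA_prec (fint u) (fint v) = fint_prec u v.
Proof. by rewrite /calA_prec !coords_fint bilinextUU. Qed.
Lemma calA_succ_fint (u v : word) : calA_succ (fint u) (fint v) = fint_succ u v.
Proof. by rewrite /calA_succ !coords_fint bilinextUU. Qed.

Definition calA_dend : aug_dend_data R :=
  @AugDend R calA (fint [::]) (lspan [set fint w | w in [set w | ~~ nilp w]])
    calA_prec calA_succ.

Definition calA_conv : set calA :=
  lspan [set fint w | w in [set w | conv_word w]].

(* Only meaningful for convergent words: the integral is 0 by convention when
   it is infinite. *)
Definition integral_value (w : word) : R :=
  \int[lebn (size w)]_(t in simplex (size w))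
    \prod_(i < size w) g (tnth (in_tuple w) i) (tnth t i).

Definition ev : calA -> R^o :=
  fun a => linext (fun w => if nilp w then 1 else integral_value w) (coords a).

Lemma ev_is_linear : linear ev.
Proof. by move=> c a b; rewrite /ev coords_is_linear linearP. Qed.

Lemma ev_fint (w : word) :
  ev (fint w) = if nilp w then 1 else integral_value w.
Proof. by rewrite /ev coords_fint linextU. Qed.

Definition zeta_int : Words R -> R^o :=
  linext (fun w => if nilp w then 1 else integral_value w).

End formal_integrals.

Inductive tree := Leaf | Node (l : tree) (z : letter) (r : tree).
HB.instance Definition _ := gen_eqMixin tree.
HB.instance Definition _ := gen_choiceMixin tree.

Definition is_leaf (t : tree) : bool := if t is Leaf then true else false.

(* An item of a ladder: the decoration of its node, and the subtree grafted
   to the left ([inl]) or to the right ([inr]) of it. *)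
Definition item : Type := letter * (tree + tree).

Fixpoint right_branch (t : tree) : seq item :=
  if t is Node l z r then (z, inl l) :: right_branch r else [::].

Fixpoint left_branch (t : tree) : seq item :=
  if t is Node l z r then (z, inr r) :: left_branch l else [::].

Definition ladder (s : seq item) : tree :=
  foldr (fun (it : item) (above : tree) =>
    match it.2 with
    | inl F => Node F it.1 above
    | inr F => Node above it.1 F
    end) Leaf s.

Definition Dend (R : realType) : lmodType R := {malg R[tree]}.

Section trees.
Context (R : realType).

Definition Y (z : letter) : Dend R := << Node Leaf z Leaf >>.

Definition tree_prec (t s : tree) : Dend R :=
  if is_leaf t then 0 else if is_leaf s then << t >> else
  \sum_(p in Sh (size (right_branch t)) (size (left_branch s)) | inv0 p 0)
    << ladder (merge_by p) >>.

Definition tree_succ (t s : tree) : Dend R :=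
  if is_leaf s then 0 else if is_leaf t then << s >> else
  \sum_(p in Sh (size (right_branch t)) (size (left_branch s))
        | inv0 p (size (right_branch t)))
    << ladder (merge_by p) >>.

Definition Dend_dend : aug_dend_data R :=
  @AugDend R (Dend R) << Leaf >>
    (lspan [set << t >> | t in [set t | ~~ is_leaf t]])
    (bilinext tree_prec) (bilinext tree_succ).

Fixpoint maximal_letters (t : tree) : seq letter :=
  match t with
  | Leaf => [::]
  | Node Leaf z Leaf => [:: z]
  | Node l _ r => maximal_letters l ++ maximal_letters r
  end.

Definition conv_tree (t : tree) : bool :=
  if t is Node _ z _ then (z == Lx) && all (pred1 Ly) (maximal_letters t)
  else true.

Definition Dend_conv : set (Dend R) :=
  lspan [set << t >> | t in [set t | conv_tree t]].

(* [Dend_dend] is free on [Y Lx] and [Y Ly], so that there is exactly one such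
   morphism. *)
Definition zeta_Dend : Dend_dend -> calA_dend R :=
  xget (fun=> 0) [set f : Dend_dend -> calA_dend R |
    dend_morphism f /\ forall z, f (Y z) = fint R [:: z]].

Fixpoint flat_tree (t : tree) : Words R :=
  if t is Node l z r then wcons z (shuffle (flat_tree l) (flat_tree r))
  else << [::] >>.

Definition flat : Dend R -> Words R := linext flat_tree.

End trees.

(* Main.v *)
(** The map [zeta_FI \o flat] is a dendriform morphism with the values of
    [zeta_Dend] on the generators [Y z], and such a morphism is unique because
    [Node l z r = (l > Y z) < r]. The half products of trees and of formal
    integrals are sums over [Sh k l] of merged ladders or words, whose first
    item is prescribed. Removing that first item (through [lift_perm]) turns
    such a sum into one over the recursive list of shuffles, so that on both
    sides [(a p) < q = a (p * q)] and [p > (b q) = b (p * q)], where [*] is the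
    shuffle product. Compatibility with [flat] then reduces to the associativity
    and commutativity of [*]. For convergence, words that end with [y] span a
    space closed under [*] and under adding letters in front. *)

Require Import Defs.
From mathcomp Require Import all_boot all_order all_algebra all_fingroup.
From mathcomp Require Import finmap monalg.
From mathcomp Require Import all_classical all_reals.

Set Implicit Arguments.
Unset Strict Implicit.
Unset Printing Implicit Defensive.

Import GRing.Theory.
Local Open Scope classical_set_scope.
Local Open Scope ring_scope.

(** * Lists of shuffles of two sequences *)

Section shuffles.
Context {T : Type}.
Implicit Types (u v x : seq T).

(** The recursion of [shuffle_word], with lists in place of formal sums and over any type, so that
    it serves for words and for ladders alike. *)
Fixpoint shuffles u : seq T -> seq (seq T) :=
  if u is a :: u' then
    fix shuffles_u v : seq (seq T) :=
      if v is b :: v' then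
        map (cons a) (shuffles u' v) ++ map (cons b) (shuffles_u v')
      else [:: u]
  else fun v => [:: v].

Lemma shuffles0r u : shuffles u [::] = [:: u].
Proof. by case: u. Qed.

Lemma shuffles_cons a b u v :
  shuffles (a :: u) (b :: v) =
  map (cons a) (shuffles u (b :: v)) ++ map (cons b) (shuffles (a :: u) v).
Proof. by []. Qed.

End shuffles.

(** * Permutations that increase on each of two blocks *)

(** The condition defining [Sh], with the degree [n] kept separate from the cut [k], so that
    inductions on [n] need no casts. *)
Definition block_increasing k n (s : 'S_n) : bool :=
  [forall i : 'I_n, forall j : 'I_n,
    (i < j)%N && ((j < k)%N || (k <= i)%N) ==> (s i < s j)%N].

Lemma block_increasingP k n (s : 'S_n) :
  reflect (forall i j : 'I_n, (i < j)%N -> (j < k)%N || (k <= i)%N -> (s i < s j)%N)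
          (block_increasing k s).
Proof.
apply: (iffP forallP) => [h i j ij kij|h i].
  by move: (h i) => /forallP/(_ j); rewrite ij kij.
by apply/forallP => j; apply/implyP => /andP[]; exact: h.
Qed.

(** The index sent to [ord0] comes first in its block, since an earlier one there would need a
    smaller image. *)
Lemma block_increasing_first k n (s : 'S_n.+1) : block_increasing k s ->
  s ord0 = ord0 \/ exists2 m : 'I_n.+1, m = k :> nat & s m = ord0.
Proof.
move=> /block_increasingP h; pose m := (s^-1)%g ord0.
have sm : s m = ord0 by rewrite permKV.
have [mk|km] := ltnP m k.
  left; have [/eqP m0|m0] := posnP m.
    by rewrite -{2}sm; congr (fun_of_perm s _); apply: val_inj; rewrite /= (eqP m0).
  by have := h ord0 m m0; rewrite mk sm => /(_ isT).
right; exists m => //; apply/eqP; rewrite eqn_leq km andbT leqNgt.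
apply/negP => km'; have kn : (k < n.+1)%N by exact: leq_ltn_trans km (ltn_ord m).
by have := h (Ordinal kn) m km'; rewrite /= leqnn orbT sm => /(_ isT).
Qed.

(** The first hypothesis says that [k'] is the cut left once [m] is removed, the second that [m] is
    first in its block. Pairs avoiding [m] are those of [s]; in the others [m] is the smaller index
    and has the smallest image. *)
Lemma block_increasing_lift k k' n (m : 'I_n.+1) (s : 'S_n) :
  (forall j : 'I_n, (lift m j < k)%N = (j < k')%N) ->
  (forall j : 'I_n.+1, (j < m)%N -> ~~ ((m < k)%N || (k <= j)%N)) ->
  block_increasing k (lift_perm m ord0 s) = block_increasing k' s.
Proof.
move=> kk' minm; have lift_lt i j : (lift m i < lift m j)%N = (i < j)%N.
  by rewrite /= !ltnNge leq_bump2.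
have ge_kk' (j : 'I_n) : (k' <= j)%N = (k <= lift m j)%N by rewrite leqNgt -kk' -leqNgt.
apply/block_increasingP/block_increasingP => h i j.
  rewrite -lift_lt -(kk' j) ge_kk' => ij kij.
  by have := h _ _ ij kij; rewrite !lift_perm_lift.
case: (unliftP m j) => [j'|] ->; case: (unliftP m i) => [i'|] ->.
- rewrite lift_lt kk' -ge_kk' !lift_perm_lift => ij kij.
  exact: h.
- by rewrite lift_perm_id lift_perm_lift.
- by move=> im; rewrite (negPf (minm _ im)).
- by rewrite ltnn.
Qed.

(** * Sums over merges as sums over lists of shuffles *)

Section merge.
Context {T : Type} (x0 : T).

(** A form of [merge_by] whose degree [n] is not tied to the length of [x], at the price of a
    default item. *)
Definition merge_nth n (x : seq T) (s : 'S_n) : seq T :=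
  [seq nth x0 x ((s^-1)%g i) | i <- enum 'I_n].

Lemma merge_by_nth (u v : seq T) s :
  @merge_by T u v s = merge_nth (u ++ v) s.
Proof. by apply: eq_map => i; rewrite (tnth_nth x0). Qed.

Lemma merge_nth_lift n (u v : seq T) b (m : 'I_n.+1) (s : 'S_n) :
  m = size u :> nat ->
  merge_nth (u ++ b :: v) (lift_perm m ord0 s) = b :: merge_nth (u ++ v) s.
Proof.
move=> mu; rewrite /merge_nth enum_ordSl /= -map_comp lift_permV lift_perm_id.
rewrite mu nth_cat ltnn subnn; congr (_ :: _); apply: eq_map => j /=.
(* Lifting skips the position [size u] of [b]: indices from there on shift by one. *)
rewrite lift_perm_lift !nth_cat /= mu /bump; case: (leqP (size u) ((s^-1)%g j)) => h.
  by rewrite ltnNge (leqW h) /= subSn.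
by rewrite add0n h.
Qed.

Context {V : nmodType}.

(** A reindexing: [lift_perm m ord0] is a bijection from ['S_n] onto the permutations that send [m]
    to [ord0]. *)
Lemma sum_lift_perm n (m : 'I_n.+1) (P : pred 'S_n.+1) (F : 'S_n.+1 -> V) :
  \sum_(s | P s && (s m == ord0)) F s =
  \sum_(s | P (lift_perm m ord0 s)) F (lift_perm m ord0 s).
Proof.
have inj : injective (fun s : 'S_n => lift_perm m ord0 s).
  move=> s t /permP e; apply/permP => i; have := e (lift m i).
  by rewrite !lift_perm_lift => /lift_inj.
have unlift_lt (s : 'S_n.+1) : s m == ord0 -> forall k, s (lift m k) != ord0.
  by move=> /eqP <- k; rewrite (inj_eq perm_inj) eq_sym neq_lift.
(* [dn s] is [s] with [m] and its image removed; the default [k] is never reached when [s m] is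
   [ord0]. *)
pose dn (s : 'S_n.+1) (k : 'I_n) := odflt k (unlift ord0 (s (lift m k))).
have dnK (s : 'S_n.+1) k : s m == ord0 -> lift ord0 (dn s k) = s (lift m k).
  move=> /unlift_lt/(_ k); rewrite /dn.
  by case: (unliftP ord0 (s (lift m k))) => [j ->|->] //; rewrite eqxx.
have dn_inj (s : 'S_n.+1) : s m == ord0 -> injective (dn s).
  by move=> sm k l /(congr1 (lift ord0)); rewrite !dnK// => /perm_inj/lift_inj.
(* The inverse bijection; when [s m] is [ord0] the choice succeeds, because the permutation given by
   [dn s] lifts to [s]. *)
pose g (s : 'S_n.+1) := odflt 1%g [pick t | lift_perm m ord0 t == s].
have gK (s : 'S_n.+1) : s m == ord0 -> lift_perm m ord0 (g s) = s.
  move=> sm; rewrite /g; case: pickP => [t /eqP//|/(_ (perm (dn_inj s sm)))/eqP[]].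
  apply/permP => k; case: (unliftP m k) => [j|] ->; last first.
    by rewrite lift_perm_id (eqP sm).
  by rewrite lift_perm_lift permE dnK.
rewrite (reindex_onto (fun s => lift_perm m ord0 s) g) => [|s /andP[_]]; last exact: gK.
apply: eq_bigl => s; rewrite lift_perm_id eqxx andbT.
rewrite (_ : g _ = s) ?eqxx ?andbT//; apply: inj; apply: gK.
by rewrite lift_perm_id.
Qed.

Lemma sum_block_increasing_cons n k k' (m : 'I_n.+1) u b v (F : seq T -> V) :
  m = size u :> nat ->
  (forall j : 'I_n, (lift m j < k)%N = (j < k')%N) ->
  (forall j : 'I_n.+1, (j < m)%N -> ~~ ((m < k)%N || (k <= j)%N)) ->
  \sum_(s : 'S_n.+1 | block_increasing k s && (s m == ord0))
    F (merge_nth (u ++ b :: v) s) =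
  \sum_(s : 'S_n | block_increasing k' s) F (b :: merge_nth (u ++ v) s).
Proof.
move=> mu kk' minm; rewrite sum_lift_perm.
by apply: eq_big => s; rewrite ?(block_increasing_lift _ kk' minm)// merge_nth_lift.
Qed.

Lemma sum_block_increasing_left n a u v (F : seq T -> V) :
  \sum_(s : 'S_n.+1 | block_increasing (size u).+1 s && (s ord0 == ord0))
    F (merge_nth (a :: u ++ v) s) =
  \sum_(s : 'S_n | block_increasing (size u) s) F (a :: merge_nth (u ++ v) s).
Proof. exact: (@sum_block_increasing_cons _ _ _ ord0 [::]). Qed.

Lemma sum_block_increasing_right n (m : 'I_n.+1) u b v (F : seq T -> V) :
  m = size u :> nat ->
  \sum_(s : 'S_n.+1 | block_increasing (size u) s && (s m == ord0))
    F (merge_nth (u ++ b :: v) s) =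
  \sum_(s : 'S_n | block_increasing (size u) s) F (b :: merge_nth (u ++ v) s).
Proof.
move=> mu; apply: sum_block_increasing_cons => // j.
  by rewrite /= mu /bump; case: (leqP (size u) j) => h; [rewrite ltnNge leqW|].
by rewrite mu ltnn /= -ltnNge.
Qed.

(** Induction on [n], splitting the permutations according to the list that provides the first
    item. *)
Lemma sum_shuffles n u v (F : seq T -> V) : n = (size u + size v)%N ->
  \sum_(s : 'S_n | block_increasing (size u) s) F (merge_nth (u ++ v) s) =
  \sum_(w <- shuffles u v) F w.
Proof.
elim: n u v F => [|n IH] u v F.
  case: u v => [|//] [|//] _; rewrite big_seq1 (big_pred1 (1%g : 'S_0)) => [|s].
    by rewrite /merge_nth (_ : enum _ = [::])//; apply: size0nil; rewrite -cardE card_ord.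
  rewrite /= [s]permS0 eqxx; apply/block_increasingP; case.
  by [].
(* When one list is empty there is a single block, so index 0 goes to 0. *)
have first0 (k : nat) (s : 'S_n.+1) : k = 0%N \/ k = n.+1 ->
    block_increasing k s -> s ord0 == ord0.
  move=> k0n /block_increasing_first[->//|[m mk sm]].
  rewrite -{2}sm; apply/eqP; congr (fun_of_perm s _); apply: val_inj => /=.
  case: k0n => kE; rewrite mk kE//.
  by have := ltn_ord m; rewrite mk kE ltnn.
case: u v => [|a u] [|b v] //= [nuv].
- rewrite big_seq1 (eq_bigl
    (fun s : 'S_n.+1 => block_increasing 0 s && (s ord0 == ord0))).
    rewrite (@sum_block_increasing_right _ ord0 [::])//=.
    by rewrite (IH [::] v (fun w => F (b :: w)))//= big_seq1.
  by move=> s; case h: block_increasing => //=; rewrite (first0 0%N)//; left.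
- rewrite big_seq1 (eq_bigl
    (fun s : 'S_n.+1 => block_increasing (size u).+1 s && (s ord0 == ord0))).
    rewrite sum_block_increasing_left (IH u [::] (fun w => F (a :: w)))//=.
    by rewrite shuffles0r big_seq1.
  move=> s; case h: block_increasing => //=; rewrite (first0 (size u).+1)//; right.
  by rewrite nuv addn0.
(* Either [a] comes first or, by [block_increasing_first], [b] does, whose index is
   [(size u).+1]. *)
- rewrite (bigID (fun s : 'S_n.+1 => s ord0 == ord0)) /= big_cat !big_map /=.
  congr (_ + _).
    by rewrite sum_block_increasing_left (IH u (b :: v) (fun w => F (a :: w))).
  have km : ((size u).+1 < n.+1)%N by rewrite ltnS nuv /= addnS ltnS leq_addr.
  rewrite (eq_bigl (fun s : 'S_n.+1 =>
    block_increasing (size u).+1 s && (s (Ordinal km) == ord0))).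
    rewrite (@sum_block_increasing_right _ (Ordinal km) (a :: u) b v F)//.
    by rewrite (IH (a :: u) v (fun w => F (b :: w)))// nuv /= addnS.
  move=> s; case h: block_increasing => //=.
  apply/idP/eqP => [s0|sm]; last first.
    by apply/eqP => s0; have /(congr1 val) := perm_inj (etrans s0 (esym sm)).
  have [s00|[m mk <-]] := block_increasing_first h; first by rewrite s00 eqxx in s0.
  by congr (fun_of_perm s _); apply: val_inj; rewrite /= mk.
Qed.

End merge.

Lemma inv0E n (s : 'S_n.+1) (m : 'I_n.+1) (k : nat) : m = k :> nat ->
  Defs.inv0 s k = (s m == ord0).
Proof.
move=> <-; apply/forallP/eqP => [/(_ ord0)/eqP/val_inj <-|sm i].
  by rewrite permKV.
by apply/implyP => /eqP i0; rewrite (_ : i = s m) ?permK// sm; apply: val_inj.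
Qed.

(** Once [a] is prescribed as first item, the rest is an arbitrary shuffle. The type [T] is later
    both [letter] and [item]. *)
Lemma sum_Sh_left (T : Type) (V : nmodType) a (u v : seq T) (F : seq T -> V) :
  \sum_(s in Sh (size (a :: u)) (size v) | Defs.inv0 s 0)
    F (@merge_by _ (a :: u) v s) =
  \sum_(w <- shuffles u v) F (a :: w).
Proof.
rewrite -(@sum_shuffles _ a _ _ _ _ (fun w => F (a :: w)) erefl).
rewrite -sum_block_increasing_left; apply: eq_big => s.
  by rewrite inE (@inv0E _ s ord0).
by move=> _; rewrite (merge_by_nth a).
Qed.

Lemma sum_Sh_right (T : Type) (V : nmodType) b (u v : seq T) (F : seq T -> V) :
  \sum_(s in Sh (size u) (size (b :: v)) | Defs.inv0 s (size u))
    F (@merge_by _ u (b :: v) s) =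
  \sum_(w <- shuffles u v) F (b :: w).
Proof.
(* In terms of [merge_nth] the degree can be rewritten with [addnS]; the type of [merge_by] forbids
   this. *)
transitivity (\sum_(s : 'S_(size u + (size v).+1) |
    block_increasing (size u) s && Defs.inv0 s (size u)) F (merge_nth b (u ++ b :: v) s)).
  by apply: eq_big => s; rewrite ?inE// (merge_by_nth b).
rewrite addnS; have m_lt : (size u < (size u + size v).+1)%N by rewrite ltnS leq_addr.
rewrite -(@sum_shuffles _ b _ _ _ _ (fun w => F (b :: w)) erefl).
rewrite -(@sum_block_increasing_right _ b _ _ (Ordinal m_lt))//.
by apply: eq_bigl => s; rewrite (@inv0E _ s (Ordinal m_lt)).
Qed.

(** * Linear maps on free modules and on spans *)

Lemma linear_fun0 (R : comNzRingType) (V W : lmodType R) (h : V -> W) :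
  linear h -> h 0 = 0.
Proof. by move=> /(_ (-1) 0 0); rewrite scaler0 addr0 scaleN1r addNr. Qed.

Section linear_extension_theory.
Context {R : comNzRingType} {K L : choiceType} {V W : lmodType R}.

Lemma malg_span (P : set {malg R[K]}) :
  subspace P -> (forall k, P << k >>) -> forall p, P p.
Proof.
move=> [P0 PD] Pk p; rewrite [p]monalgE.
elim: (enum_fset (msupp p)) => [|k s IH]; first by rewrite big_nil.
rewrite big_cons; have -> : << p@_k *g k >> = p@_k *: << k >> :> {malg R[K]}.
  by apply/malgP => l; rewrite mcoeffZ !mcoeffU mulrnAr mulr1.
exact: PD.
Qed.

Lemma subspace_preim (h : V -> W) (S : set W) :
  linear h -> subspace S -> subspace (h @^-1` S).
Proof.
move=> hl [S0 SD]; split=> [|c u v Su Sv] /=; last by rewrite hl; exact: SD.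
by rewrite linear_fun0.
Qed.

(** The preimage of [T] is a subspace that contains [S], hence its span. *)
Lemma lspan_linear (h : V -> W) (S : set V) (T : set W) :
  linear h -> subspace T -> (forall s, S s -> T (h s)) ->
  forall t, lspan S t -> T (h t).
Proof.
move=> hl sT ST t /(_ (h @^-1` T)); apply; split => //.
exact: subspace_preim.
Qed.

Lemma eq_linear_malg (h1 h2 : {malg R[K]} -> V) : linear h1 -> linear h2 ->
  (forall k, h1 << k >> = h2 << k >>) -> h1 =1 h2.
Proof.
move=> l1 l2 h12; apply: malg_span => //; split=> [|c u v /= hu hv].
  by rewrite /= !linear_fun0.
by rewrite l1 l2 hu hv.
Qed.

Lemma bilinext_linextl (f : K -> L -> V) p q :
  bilinext f p q = linext (fun k => linext (f k) q) p.
Proof.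
by apply: eq_bigr => k _; rewrite scaler_sumr; apply: eq_bigr => l _; rewrite scalerA.
Qed.

Lemma bilinext_linextr (f : K -> L -> V) p q :
  bilinext f p q = linext (fun l => linext (f^~ l) p) q.
Proof.
rewrite /bilinext exchange_big; apply: eq_bigr => l _; rewrite scaler_sumr.
by apply: eq_bigr => k _; rewrite scalerA mulrC.
Qed.

Lemma bilinext_linearl (f : K -> L -> V) q : linear (bilinext f ^~ q).
Proof. by move=> c u v; rewrite !bilinext_linextl linearP. Qed.

Lemma bilinext_linearr (f : K -> L -> V) p : linear (bilinext f p).
Proof. by move=> c u v; rewrite !bilinext_linextr linearP. Qed.

End linear_extension_theory.

(** The difference of the two maps sends the generators into the subspace reduced to 0. *)
Lemma eq_linear_lspan (R : comNzRingType) (K : choiceType) (V : lmodType R)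
    (P : set K) (h1 h2 : {malg R[K]} -> V) : linear h1 -> linear h2 ->
  (forall k, P k -> h1 << k >> = h2 << k >>) ->
  forall p, lspan [set << k >> | k in P] p -> h1 p = h2 p.
Proof.
move=> l1 l2 h12 p hp; apply/eqP; rewrite -subr_eq0; apply/eqP; move: p hp.
have l12 : linear (fun p => h1 p - h2 p).
  by move=> c u v; rewrite l1 l2 scalerBr opprD addrACA.
apply: (lspan_linear (T := [set 0]) l12).
  by split=> // a u v -> ->; rewrite scaler0 addr0.
by move=> _ [k Pk <-]; rewrite /= h12// subrr.
Qed.

Lemma linear_sum_seq (R : comNzRingType) (V W : lmodType R) (h : V -> W)
    (I : Type) (r : seq I) (F : I -> V) : linear h ->
  h (\sum_(i <- r) F i) = \sum_(i <- r) h (F i).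
Proof.
move=> hl; apply: (big_morph h) => [x y|].
  by have := hl 1 x y; rewrite !scale1r.
exact: linear_fun0.
Qed.

(* The induction step for the associativity of the shuffle product. It is
   stated for abstract operations because unification unfolds [wcons] and
   [shuffle] when rewriting with their concrete versions. *)
Lemma rec_product_assoc (V : nmodType) (I : Type) (cons : I -> V -> V) (m : V -> V -> V) :
  (forall a, {morph cons a : p q / p + q}) ->
  left_distributive m +%R -> right_distributive m +%R ->
  (forall a b p q, m (cons a p) (cons b q) =
     cons a (m p (cons b q)) + cons b (m (cons a p) q)) ->
  forall a b c p q r (A := cons a p) (B := cons b q) (C := cons c r),
  m p (m B C) = m (m p B) C -> m A (m q C) = m (m A q) C ->
  m A (m B r) = m (m A B) r -> m A (m B C) = m (m A B) C.
Proof.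
move=> consD mDl mDr mcons a b c p q r A B C eqp eqq eqr.
rewrite [in LHS]mcons mDr !mcons addrACA -consD -mDr -mcons eqp eqq eqr.
by rewrite [m A B]mcons !mDl !mcons consD addrACA addrA.
Qed.

(** * The shuffle algebra: unit, commutativity, associativity *)

Section shuffle_algebra.
Context {R : realType}.
Implicit Types (p q r : Words R) (u v w : word).

Lemma wconsU a w : wcons a << w >> = << a :: w >> :> Words R.
Proof. exact: linextU. Qed.

Lemma wcons_linear a : linear (@wcons R a).
Proof. exact: linext_is_linear. Qed.

Lemma wconsD a p q : wcons a (p + q) = wcons a p + wcons a q.
Proof. exact: raddfD. Qed.

Lemma shuffle_linearl q : linear (fun p => shuffle p q).
Proof. exact: bilinext_linearl. Qed.

Lemma shuffle_linearr p : linear (shuffle p).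
Proof. exact: bilinext_linearr. Qed.

Lemma shuffleDl p q r : shuffle (p + q) r = shuffle p r + shuffle q r.
Proof. by have := shuffle_linearl r 1 p q; rewrite !scale1r. Qed.

Lemma shuffleDr p q r : shuffle r (p + q) = shuffle r p + shuffle r q.
Proof. by have := shuffle_linearr r 1 p q; rewrite !scale1r. Qed.

Lemma shuffleUU u v : shuffle << u >> << v >> = shuffle_word R u v.
Proof. exact: bilinextUU. Qed.

Lemma shuffle1p p : shuffle << [::] >> p = p.
Proof.
move: p; apply: eq_linear_malg => [|c u v //|v]; first exact: shuffle_linearr.
by rewrite shuffleUU.
Qed.

Lemma shuffle_word0r u : shuffle_word R u [::] = << u >>.
Proof. by case: u. Qed.

Lemma shufflep1 p : shuffle p << [::] >> = p.
Proof.
move: p; apply: (eq_linear_malg (h1 := fun p => shuffle p _)) => [|c u v //|v].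
  exact: shuffle_linearl.
by rewrite shuffleUU shuffle_word0r.
Qed.

(** The recursion of [shuffle_word], extended by linearity in [p] and then in [q]. *)
Lemma shuffle_wcons a b p q :
  shuffle (wcons a p) (wcons b q) =
  wcons a (shuffle p (wcons b q)) + wcons b (shuffle (wcons a p) q).
Proof.
move: p; apply: (eq_linear_malg (h1 := fun p => _) (h2 := fun p => _)).
- by move=> c x y; rewrite wcons_linear shuffle_linearl.
- move=> c x y; rewrite wcons_linear !shuffle_linearl !wcons_linear.
  by rewrite scalerDr addrACA.
move=> u; move: q; apply: (eq_linear_malg (h1 := fun p => _) (h2 := fun p => _)).
- by move=> c x y; rewrite wcons_linear shuffle_linearr.
- move=> c x y; rewrite wcons_linear !shuffle_linearr !wcons_linear.
  by rewrite scalerDr addrACA.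
by move=> v; rewrite !wconsU !shuffleUU.
Qed.

Lemma shuffle_wordC u v : shuffle_word R u v = shuffle_word R v u.
Proof.
elim: u v => [|a u IHu] v; first by rewrite shuffle_word0r.
elim: v => [//|b v IHv] /=; rewrite (IHu (b :: v)) -IHv; exact: addrC.
Qed.

Lemma shuffleC p q : shuffle p q = shuffle q p.
Proof.
move: p; apply: (eq_linear_malg (h1 := fun p => shuffle p q)).
- exact: shuffle_linearl.
- exact: shuffle_linearr.
move=> u; move: q; apply: (eq_linear_malg (h2 := fun q => shuffle q _)).
- exact: shuffle_linearr.
- exact: shuffle_linearl.
by move=> v; rewrite !shuffleUU shuffle_wordC.
Qed.

Lemma shuffleA p q r : shuffle p (shuffle q r) = shuffle (shuffle p q) r.
Proof.
move: p; apply: (eq_linear_malg (h1 := fun p => _) (h2 := fun p => _)).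
- by move=> c x y; rewrite shuffle_linearl.
- by move=> c x y; rewrite !shuffle_linearl.
move=> u; move: q; apply: (eq_linear_malg (h1 := fun p => _) (h2 := fun p => _)).
- by move=> c x y; rewrite shuffle_linearl shuffle_linearr.
- by move=> c x y; rewrite shuffle_linearr shuffle_linearl.
move=> v; move: r; apply: (eq_linear_malg (h1 := fun p => _) (h2 := fun p => _)).
- by move=> c x y; rewrite !shuffle_linearr.
- by move=> c x y; rewrite shuffle_linearr.
(* Nested inductions on the three words provide the three hypotheses of [rec_product_assoc], each of
   which shortens one word. *)
elim: u v => [|a u IHu] v w; first by rewrite !shuffle1p.
elim: v w => [|b v IHv] w; first by rewrite shuffle1p shufflep1.
elim: w => [|c w IHw]; first by rewrite !shufflep1.
have := @rec_product_assoc (Words R) letter (@wcons R) (@shuffle R) wconsD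
  (fun x y z => shuffleDl x y z) (fun x y z => shuffleDr y z x) shuffle_wcons
  a b c << u >> << v >> << w >>.
by rewrite /= !wconsU; apply; [exact: IHu|exact: IHv|exact: IHw].
Qed.

Lemma shuffle_wordE u v :
  shuffle_word R u v = \sum_(w <- shuffles u v) << w >>.
Proof.
elim: u v => [|a u IHu] v; first by rewrite big_seq1.
elim: v => [|b v IHv]; first by rewrite big_seq1.
(* Folding the inner fixpoint back makes [IHv] applicable. *)
rewrite shuffles_cons big_cat !big_map [LHS]/= -/(shuffle_word R (a :: u)).
rewrite IHu IHv !(linear_sum_seq _ _ (wcons_linear _)).
by congr (_ + _); apply: eq_bigr => w _; exact: wconsU.
Qed.

End shuffle_algebra.

(** * Half products of formal integrals *)

Section zeta_morphism.
Context {R : realType}.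
Implicit Types (p q : Words R) (u v w : word) (t s l r : tree) (x y : seq item).

Lemma zeta_FI_linear : linear (@zeta_FI R).
Proof. exact: linext_is_linear. Qed.

Lemma flat_linear : linear (@flat R).
Proof. exact: linext_is_linear. Qed.

Lemma flatU t : flat << t >> = flat_tree R t.
Proof. exact: linextU. Qed.

Lemma zeta_FIU w : zeta_FI << w >> = fint R w.
Proof. exact: linextU. Qed.

Lemma sum_fint_shuffles a u v :
  \sum_(w <- shuffles u v) fint R (a :: w) = zeta_FI (wcons a (shuffle_word R u v)).
Proof.
rewrite shuffle_wordE (linear_sum_seq _ _ (wcons_linear a)).
rewrite (linear_sum_seq _ _ zeta_FI_linear); apply: eq_bigr => w _.
by rewrite wconsU zeta_FIU.
Qed.

Lemma fint_prec_cons a u v :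
  fint_prec R (a :: u) v = zeta_FI (wcons a (shuffle_word R u v)).
Proof.
case: v => [|b v]; first by rewrite shuffle_word0r wconsU zeta_FIU.
by rewrite -sum_fint_shuffles; exact: sum_Sh_left.
Qed.

Lemma fint_succ_cons b u v :
  fint_succ R u (b :: v) = zeta_FI (wcons b (shuffle_word R u v)).
Proof.
case: u => [|a u]; first by rewrite wconsU zeta_FIU.
by rewrite -sum_fint_shuffles; exact: (sum_Sh_right b (a :: u)).
Qed.

(** By bilinearity this is [fint_prec_cons]. The letter [a] keeps the left factor away from the
    empty word, where [fint_prec] is 0; [q] may involve the empty word. *)
Lemma calA_prec_wcons a p q :
  calA_prec (zeta_FI (wcons a p)) (zeta_FI q) = zeta_FI (wcons a (shuffle p q)).
Proof.
rewrite /calA_prec !zeta_FIK.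
move: p; apply: (eq_linear_malg (h1 := fun p => _) (h2 := fun p => _)).
- by move=> c x y; rewrite wcons_linear bilinext_linearl.
- by move=> c x y; rewrite shuffle_linearl wcons_linear zeta_FI_linear.
move=> u; move: q; apply: (eq_linear_malg (h1 := fun p => _) (h2 := fun p => _)).
- by move=> c x y; rewrite bilinext_linearr.
- by move=> c x y; rewrite shuffle_linearr wcons_linear zeta_FI_linear.
by move=> v; rewrite wconsU bilinextUU fint_prec_cons shuffleUU.
Qed.

Lemma calA_succ_wcons b p q :
  calA_succ (zeta_FI p) (zeta_FI (wcons b q)) = zeta_FI (wcons b (shuffle p q)).
Proof.
rewrite /calA_succ !zeta_FIK.
move: p; apply: (eq_linear_malg (h1 := fun p => _) (h2 := fun p => _)).
- by move=> c x y; rewrite bilinext_linearl.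
- by move=> c x y; rewrite shuffle_linearl wcons_linear zeta_FI_linear.
move=> u; move: q; apply: (eq_linear_malg (h1 := fun p => _) (h2 := fun p => _)).
- by move=> c x y; rewrite wcons_linear bilinext_linearr.
- by move=> c x y; rewrite shuffle_linearr wcons_linear zeta_FI_linear.
by move=> v; rewrite wconsU bilinextUU fint_succ_cons shuffleUU.
Qed.

(** * Flattening ladders and half products of trees *)

Definition item_tree (it : item) : tree :=
  match it.2 with inl F => F | inr F => F end.

(** By commutativity of the shuffle product, the side on which a subtree is grafted does not affect
    the flattening. *)
Lemma flat_ladder_cons it x :
  flat_tree R (ladder (it :: x)) =
  wcons it.1 (shuffle (flat_tree R (item_tree it)) (flat_tree R (ladder x))).
Proof.
case: it => z [F|F]; first by [].
by congr (wcons z _); exact: shuffleC.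
Qed.

(** Double induction: the recursion of [shuffles] matches [shuffle_wcons] once the flattened grafted
    subtrees are moved through the products. *)
Lemma flat_ladder_shuffles x y :
  \sum_(w <- shuffles x y) flat_tree R (ladder w) =
  shuffle (flat_tree R (ladder x)) (flat_tree R (ladder y)).
Proof.
elim: x y => [|i x IHx] y; first by rewrite big_seq1 shuffle1p.
elim: y => [|j y IHy]; first by rewrite big_seq1 shufflep1.
(* A common bottom item comes out of the sum by linearity. *)
have sum_cons k (ws : seq (seq item)) :
    \sum_(w <- ws) flat_tree R (ladder (k :: w)) =
    wcons k.1 (shuffle (flat_tree R (item_tree k))
                       (\sum_(w <- ws) flat_tree R (ladder w))).
  elim: ws => [|w ws IH].
    rewrite !big_nil.
    by rewrite (linear_fun0 (shuffle_linearr _)) (linear_fun0 (wcons_linear _)).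
  rewrite !big_cons flat_ladder_cons IH -(wconsD k.1); congr (wcons _ _).
  by apply: esym; exact: shuffleDr.
rewrite shuffles_cons big_cat !big_map !sum_cons IHx IHy !flat_ladder_cons.
set p := flat_tree R (ladder x); set q := flat_tree R (ladder y).
set f := flat_tree R (item_tree i); set g := flat_tree R (item_tree j).
rewrite (shuffle_wcons i.1 j.1 (shuffle f p) (shuffle g q)).
rewrite (shuffleA f p) (shuffleA g _ q) (shuffleC g (wcons _ _)).
by rewrite -(shuffleA _ g q).
Qed.

Lemma ladder_right_branch t : ladder (right_branch t) = t.
Proof. by elim: t => //= l _ z r {2}<-. Qed.

Lemma ladder_left_branch t : ladder (left_branch t) = t.
Proof. by elim: t => //= l {2}<- z r _. Qed.

(** The root, with [l] on its left, is the first item of the right branch; it stays at the bottom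
    while the right branch of [r] is shuffled with the left branch of [t]. *)
Lemma tree_prec_node l z r t :
  tree_prec R (Node l z r) t =
  \sum_(w <- shuffles (right_branch r) (left_branch t)) << Node l z (ladder w) >>.
Proof.
case: t => [|l' z' r']; first by rewrite shuffles0r big_seq1 ladder_right_branch.
exact: (@sum_Sh_left item (Dend R) (z, inl l) (right_branch r)
  (left_branch (Node l' z' r')) (fun x => << ladder x >>)).
Qed.

Lemma tree_succ_node l z r t :
  tree_succ R t (Node l z r) =
  \sum_(w <- shuffles (right_branch t) (left_branch l)) << Node (ladder w) z r >>.
Proof.
case: t => [|l' z' r']; first by rewrite big_seq1 ladder_left_branch.
exact: (@sum_Sh_right item (Dend R) (z, inr r) (right_branch (Node l' z' r'))
  (left_branch l) (fun x => << ladder x >>)).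
Qed.

(** The counterpart of [calA_prec_wcons] for trees; associativity regroups the three factors. *)
Lemma flat_tree_prec l z r t :
  flat (tree_prec R (Node l z r) t) =
  wcons z (shuffle (shuffle (flat_tree R l) (flat_tree R r)) (flat_tree R t)).
Proof.
rewrite tree_prec_node (linear_sum_seq _ _ flat_linear).
under eq_bigr => w _ do rewrite flatU /=.
rewrite -(linear_sum_seq _ _ (wcons_linear z)); congr (wcons z _).
rewrite -(linear_sum_seq _ _ (shuffle_linearr _)) flat_ladder_shuffles.
by rewrite ladder_right_branch ladder_left_branch shuffleA.
Qed.

Lemma flat_tree_succ l z r t :
  flat (tree_succ R t (Node l z r)) =
  wcons z (shuffle (flat_tree R t) (shuffle (flat_tree R l) (flat_tree R r))).
Proof.
rewrite tree_succ_node (linear_sum_seq _ _ flat_linear).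
under eq_bigr => w _ do rewrite flatU /=.
rewrite -(linear_sum_seq _ _ (wcons_linear z)); congr (wcons z _).
rewrite -(linear_sum_seq _ _ (shuffle_linearl _)) flat_ladder_shuffles.
by rewrite ladder_right_branch ladder_left_branch shuffleA.
Qed.

(** * The composite is the dendriform morphism [zeta_Dend] *)

Definition zeta_flat : Dend_dend R -> calA_dend R := fun d => zeta_FI (flat d).

Lemma zeta_flat_linear : linear zeta_flat.
Proof. by move=> c u v; rewrite /zeta_flat flat_linear zeta_FI_linear. Qed.

Lemma zeta_flat_aug (t : Dend_dend R) : aug_ideal t -> aug_ideal (zeta_flat t).
Proof.
move: t; apply: lspan_linear; [exact: zeta_flat_linear|exact: lspan_subspace|].
move=> _ [[|l z r] // _ <-]; rewrite /zeta_flat flatU /=.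
(* The root letter in front makes every word nonempty, whatever the shuffle product is. *)
move: (shuffle _ _); apply: (malg_span (P := fun p => _ (zeta_FI (wcons z p)))).
  apply: subspace_preim; last exact: lspan_subspace.
  by move=> c u v; rewrite wcons_linear zeta_FI_linear.
move=> w W [_]; apply; exists (z :: w) => //.
by rewrite wconsU zeta_FIU.
Qed.

Lemma zeta_flat_prec (a b : Dend_dend R) : aug_ideal a -> aug_ideal b ->
  zeta_flat (dend_prec a b) = dend_prec (zeta_flat a) (zeta_flat b).
Proof.
move=> ha _; move: a ha; apply: eq_linear_lspan.
- by move=> c u v; rewrite /= bilinext_linearl zeta_flat_linear.
- move=> c u v; rewrite zeta_flat_linear /= /calA_prec.
  by rewrite coords_is_linear bilinext_linearl.
move=> [|l z r] // _; move: b; apply: eq_linear_malg.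
- by move=> c u v; rewrite /= bilinext_linearr zeta_flat_linear.
- move=> c u v; rewrite zeta_flat_linear /= /calA_prec.
  by rewrite coords_is_linear bilinext_linearr.
move=> t; rewrite /zeta_flat /= bilinextUU !flatU flat_tree_prec.
by rewrite calA_prec_wcons.
Qed.

Lemma zeta_flat_succ (a b : Dend_dend R) : aug_ideal a -> aug_ideal b ->
  zeta_flat (dend_succ a b) = dend_succ (zeta_flat a) (zeta_flat b).
Proof.
move=> _ hb; move: b hb; apply: eq_linear_lspan.
- by move=> c u v; rewrite /= bilinext_linearr zeta_flat_linear.
- move=> c u v; rewrite zeta_flat_linear /= /calA_succ.
  by rewrite coords_is_linear bilinext_linearr.
move=> [|l z r] // _; move: a; apply: eq_linear_malg.
- by move=> c u v; rewrite /= bilinext_linearl zeta_flat_linear.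
- move=> c u v; rewrite zeta_flat_linear /= /calA_succ.
  by rewrite coords_is_linear bilinext_linearl.
move=> t; rewrite /zeta_flat /= bilinextUU !flatU flat_tree_succ.
by rewrite calA_succ_wcons.
Qed.

Lemma zeta_flat_morphism : dend_morphism zeta_flat.
Proof.
split.
- exact: zeta_flat_linear.
- by rewrite /zeta_flat flatU zeta_FIU.
- exact: zeta_flat_aug.
- exact: zeta_flat_prec.
- exact: zeta_flat_succ.
Qed.

Lemma zeta_flat_Y z : zeta_flat (Y R z) = fint R [:: z].
Proof. by rewrite /zeta_flat flatU /= shuffle1p wconsU zeta_FIU. Qed.

(** Induction on trees through [Node l z r = (l > Y z) < r]. Leaves are treated apart, as morphisms
    preserve the half products only on the augmentation ideal. *)
Lemma dend_morphism_unique (A : aug_dend_data R) (f1 f2 : Dend_dend R -> A) :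
  dend_morphism f1 -> dend_morphism f2 -> (forall z, f1 (Y R z) = f2 (Y R z)) ->
  f1 =1 f2.
Proof.
move=> m1 m2 f12; apply: eq_linear_malg.
- exact: dend_morph_linear m1.
- exact: dend_morph_linear m2.
have aug t : ~~ is_leaf t -> @aug_ideal R (Dend_dend R) << t >>.
  by move=> tl W [_]; apply; exists t.
elim=> [|l IHl z r IHr]; first by rewrite (dend_morph1 m1) (dend_morph1 m2).
have {IHl} Nl : f1 << Node l z Leaf >> = f2 << Node l z Leaf >>.
  case: l IHl => [_|l1 y l2 IHl]; first exact: f12.
  have -> : << Node (Node l1 y l2) z Leaf >> =
      @dend_succ R (Dend_dend R) << Node l1 y l2 >> (Y R z).
    by rewrite /= bilinextUU tree_succ_node shuffles0r big_seq1 ladder_right_branch.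
  by rewrite (dend_morph_succ m1) ?(dend_morph_succ m2) ?IHl ?f12//; exact: aug.
case: r IHr => [//|r1 y r2 IHr].
have -> : << Node l z (Node r1 y r2) >> =
    @dend_prec R (Dend_dend R) << Node l z Leaf >> << Node r1 y r2 >>.
  by rewrite /= bilinextUU tree_prec_node big_seq1 ladder_left_branch.
by rewrite (dend_morph_prec m1) ?(dend_morph_prec m2) ?IHr ?Nl//; exact: aug.
Qed.

(** [zeta_flat] shows that the set from which [zeta_Dend] is chosen is inhabited, so the choice lies
    in it and uniqueness applies. *)
Lemma zeta_DendE (t : Dend R) : zeta_Dend t = zeta_FI (flat t).
Proof.
have [m e] := xgetI (fun=> 0) (conj zeta_flat_morphism zeta_flat_Y :
  [set f : Dend_dend R -> calA_dend R |
    dend_morphism f /\ forall z, f (Y R z) = fint R [:: z]] zeta_flat).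
apply: (dend_morphism_unique m zeta_flat_morphism) => z.
by rewrite e zeta_flat_Y.
Qed.

End zeta_morphism.

(** * Preservation of convergence *)

Section convergence.
Context {R : realType}.
Implicit Types (u v w : word) (t : tree).

(* The default [Lx] excludes the empty word. *)
Definition ends_with_y w : bool := last Lx w == Ly.

(** The invariant for subtrees: the condition on the first letter is only available at the root of
    the whole tree. *)
Definition Wends : set (Words R) := lspan [set << w >> | w in ends_with_y].

Lemma Wends_subspace : subspace Wends.
Proof. exact: lspan_subspace. Qed.

Lemma WendsU w : ends_with_y w -> Wends << w >>.
Proof. by move=> wy W [_]; apply; exists w. Qed.

Lemma Wends_wcons a (p : Words R) : Wends p -> Wends (wcons a p).
Proof.
apply: lspan_linear; [exact: wcons_linear|exact: Wends_subspace|].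
by move=> _ [[|b w] // wy <-]; rewrite wconsU; exact: WendsU.
Qed.

Lemma WendsD (p q : Words R) : Wends p -> Wends q -> Wends (p + q).
Proof. by move=> hp hq; rewrite -[p]scale1r; exact: Wends_subspace.2. Qed.

(** A nonempty shuffle ends with the last letter of [u] or of [v]. The case of an empty [u] is
    included because the induction can exhaust [u]. *)
Lemma Wends_shuffle_word u v :
  nilp u || ends_with_y u -> ends_with_y v -> Wends (shuffle_word R u v).
Proof.
elim: u v => [|a u IHu] v; first by move=> _ /WendsU.
rewrite /= => au; elim: v => [//|b v IHv] bv.
have uy : nilp u || ends_with_y u by move: au; case: (u).
apply: WendsD; apply: Wends_wcons; first exact: IHu.
(* If [v] is exhausted, what remains is [a :: u], which ends with [Ly] by [au]. *)
by case: v bv IHv => [_ _|c v bv]; [exact: WendsU|exact].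
Qed.

Lemma Wends_shuffle (p q : Words R) : Wends p -> Wends q -> Wends (shuffle p q).
Proof.
move=> hp hq; move: p hp; apply: lspan_linear.
- exact: shuffle_linearl.
- exact: Wends_subspace.
move=> _ [u uy <-]; move: q hq; apply: lspan_linear.
- exact: shuffle_linearr.
- exact: Wends_subspace.
move=> _ [v vy <-]; rewrite shuffleUU; apply: Wends_shuffle_word => //.
by rewrite [ends_with_y u]uy orbT.
Qed.

(** A single leaf flattens to the unit of the shuffle product; two leaves would give the empty
    word. *)
Lemma Wends_shuffle_flat l r : ~~ (is_leaf l && is_leaf r) ->
  (~~ is_leaf l -> Wends (flat_tree R l)) ->
  (~~ is_leaf r -> Wends (flat_tree R r)) ->
  Wends (shuffle (flat_tree R l) (flat_tree R r)).
Proof.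
case: l r => [|l1 y l2] [|r1 z r2] // _.
- by move=> _ /(_ isT); rewrite shuffle1p.
- by move=> /(_ isT) + _; rewrite shufflep1.
- by move=> /(_ isT) hl /(_ isT) hr; exact: Wends_shuffle.
Qed.

Lemma maximal_letters_node l z r : ~~ (is_leaf l && is_leaf r) ->
  maximal_letters (Node l z r) = maximal_letters l ++ maximal_letters r.
Proof. by case: l r => [|? ? ?] []. Qed.

Lemma Wends_flat t : ~~ is_leaf t -> all (pred1 Ly) (maximal_letters t) ->
  Wends (flat_tree R t).
Proof.
elim: t => [//|l IHl z r IHr] _.
have [/andP[]|lr] := boolP (is_leaf l && is_leaf r).
  case: l r {IHl IHr} => [|//] [|//] _ _ /=; rewrite andbT => /eqP ->.
  by rewrite shuffle1p wconsU; exact: WendsU.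
rewrite maximal_letters_node// all_cat => /andP[hl hr].
by apply: Wends_wcons; apply: Wends_shuffle_flat => // h; [exact: IHl|exact: IHr].
Qed.

Lemma Wconv_flat (d : Dend R) : Dend_conv d -> Wconv (flat d).
Proof.
apply: lspan_linear; [exact: flat_linear|exact: lspan_subspace|].
move=> _ [t ct <-]; rewrite flatU; case: t ct => [_|l z r].
  by move=> W [_]; apply; exists [::].
move=> /andP[/eqP -> my].
(* A root with two leaves is also maximal, so it would carry [Ly] as well as [Lx]. *)
have lr : ~~ (is_leaf l && is_leaf r).
  by apply/negP; case: l r my => [|//] [|].
move: my; rewrite maximal_letters_node// all_cat => /andP[hl hr].
have : Wends (shuffle (flat_tree R l) (flat_tree R r)).
  by apply: Wends_shuffle_flat => // h; exact: Wends_flat.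
apply: lspan_linear; [exact: wcons_linear|exact: lspan_subspace|].
move=> _ [w wy <-] W [_]; apply; exists (Lx :: w); last by rewrite wconsU.
by case: w wy.
Qed.

Lemma calA_conv_zeta_FI (p : Words R) : Wconv p -> calA_conv (zeta_FI p).
Proof.
apply: lspan_linear; [exact: zeta_FI_linear|exact: lspan_subspace|].
by move=> _ [w cw <-] W [_]; apply; exists w => //; rewrite zeta_FIU.
Qed.

End convergence.

Theorem corollary7p6 (R : realType) :
  [/\ forall t : Dend R, Dend_conv t -> Wconv (flat t),
      forall t : Dend R, Dend_conv t -> zeta_FI (flat t) = zeta_Dend t,
      forall w : Words R, Wconv w -> calA_conv (zeta_FI w)
    & forall w : Words R, Wconv w -> ev (zeta_FI w) = zeta_int w].
Proof.
split=> [t|t _|w|w _].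
- exact: Wconv_flat.
- by rewrite zeta_DendE.
- exact: calA_conv_zeta_FI.
(* As [coords] inverts [zeta_FI], both sides become the same linear extension. *)
- by rewrite /ev zeta_FIK.
Qed.
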